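(* Let $G$ be a countable, infinite group. Then the group $\mathrm{Aut}(M(G),G)$ of automorphisms of the universal minimal flow has cardinality $2^{\mathfrak{c}}$. In particular, $M(G)$ is not proximal.
   Context: The universal minimal flow $M(G)$ is the (unique up to isomorphism) minimal $G$-flow admitting a $G$-equivariant continuous surjection onto every minimal $G$-flow. $\mathrm{Aut}(Y,G)$ is the group of homeomorphisms of $Y$ commuting with the $G$-action. $\mathfrak{c}$ is the cardinality of the continuum. A flow is proximal if for every two points $x_1,x_2$ there exist $y$ and a net $(g_i)$ with $g_ix_1\to y$ and $g_ix_2\to y$. *)

(* Defs.v *)
From Stdlib Require Import List.
Import ListNotations.
Set Implicit Arguments.

Record group := Group {
  gcar :> Type;
  gmul : gcar -> gcar -> gcar;
  gone : gcar;
  ginv : gcar -> gcar;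
  gmulA : forall x y z, gmul x (gmul y z) = gmul (gmul x y) z;
  gmul1 : forall x, gmul gone x = x;
  gmulV : forall x, gmul (ginv x) x = gone
}.

Definition countable_type (T : Type) : Prop :=
  exists f : T -> nat, forall x y, f x = f y -> x = y.

Definition infinite_type (T : Type) : Prop :=
  forall l : list T, exists x, ~ In x l.

Definition is_topology (X : Type) (op : (X -> Prop) -> Prop) : Prop :=
  op (fun _ => True) /\
  (forall U V, op U -> op V -> op (fun x => U x /\ V x)) /\
  (forall F : (X -> Prop) -> Prop, (forall U, F U -> op U) ->
     op (fun x => exists U, F U /\ U x)).

Definition compact_sp (X : Type) (op : (X -> Prop) -> Prop) : Prop :=
  forall F : (X -> Prop) -> Prop,
    (forall U, F U -> op U) -> (forall x, exists U, F U /\ U x) ->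
    exists l : list (X -> Prop),
      (forall U, In U l -> F U) /\ (forall x, exists U, In U l /\ U x).

Definition hausdorff_sp (X : Type) (op : (X -> Prop) -> Prop) : Prop :=
  forall x y, x <> y -> exists U V, op U /\ op V /\ U x /\ V y /\
    (forall z, U z -> V z -> False).

(** * G-flows: compact Hausdorff spaces with a continuous action of the
    discrete group G (continuity of the action = each g acts continuously). *)
Record flow (G : group) := Flow {
  fcar :> Type;
  fopen : (fcar -> Prop) -> Prop;
  ftop : is_topology fopen;
  fcompact : compact_sp fopen;
  fhausdorff : hausdorff_sp fopen;
  act : G -> fcar -> fcar;
  act1 : forall y, act (gone G) y = y;
  actM : forall g h y, act (gmul G g h) y = act g (act h y);
  act_cont : forall g U, fopen U -> fopen (fun y => U (act g y))
}.
Arguments fopen {G} f _.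
Arguments act {G} f _ _.

Definition fcontinuous {G : group} (X Y : flow G) (f : X -> Y) : Prop :=
  forall V, fopen Y V -> fopen X (fun x => V (f x)).

Definition fclosed {G : group} (X : flow G) (C : X -> Prop) : Prop :=
  fopen X (fun x => ~ C x).

Definition minimal_flow {G : group} (X : flow G) : Prop :=
  (exists x : X, True) /\
  forall C : X -> Prop, fclosed X C ->
    (forall g x, C x -> C (act X g x)) ->
    (forall x, ~ C x) \/ (forall x, C x).

Definition equivariant {G : group} (X Y : flow G) (f : X -> Y) : Prop :=
  forall g x, f (act X g x) = act Y g (f x).

Definition universal_minimal_flow {G : group} (M : flow G) : Prop :=
  minimal_flow M /\
  forall X : flow G, minimal_flow X ->
    exists f : M -> X, fcontinuous M X f /\ equivariant M X f /\
      (forall x, exists m, f m = x).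

Definition is_flow_aut {G : group} (Y : flow G) (f : Y -> Y) : Prop :=
  (exists h : Y -> Y, (forall y, h (f y) = y) /\ (forall y, f (h y) = y) /\
     fcontinuous Y Y h) /\
  fcontinuous Y Y f /\ equivariant Y Y f.

Definition flow_aut {G : group} (Y : flow G) := { f : Y -> Y | is_flow_aut Y f }.

(** Equinumerosity; the continuum c is |nat -> bool|, so 2^c is
    |(nat -> bool) -> bool|. *)
Definition equinumerous (A B : Type) : Prop :=
  exists h : A -> B, (forall x y, h x = h y -> x = y) /\ (forall b, exists a, h a = b).

Definition directed (I : Type) (le : I -> I -> Prop) : Prop :=
  (exists i : I, True) /\ (forall i, le i i) /\
  (forall i j k, le i j -> le j k -> le i k) /\
  (forall i j, exists k, le i k /\ le j k).

Definition net_converges {G : group} (Y : flow G) (I : Type) (le : I -> I -> Prop)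
    (u : I -> Y) (y : Y) : Prop :=
  forall U, fopen Y U -> U y -> exists i0, forall i, le i0 i -> U (u i).

Definition proximal_flow {G : group} (Y : flow G) : Prop :=
  forall x1 x2 : Y, exists (y : Y) (I : Type) (le : I -> I -> Prop) (g : I -> G),
    directed le /\
    net_converges Y le (fun i => act Y (g i) x1) y /\
    net_converges Y le (fun i => act Y (g i) x2) y.

(* Main.v *)
(** Ultrafilters on [G] act on every flow by limits along them. Take a minimal
closed left ideal [L] of [beta G] and an idempotent [u] of [L]. Since [L] is a
minimal flow, [M] maps to it, and this makes every element of the group [uL]
induce an automorphism of [M], distinct elements inducing distinct
automorphisms. So it is enough to find 2^c elements in [uL].

They come from a function [z] from [G] to the Boolean group [2^(2^nat)] such
that for every finite set [F] of [G], every finite set [A] of coordinates and every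
[s] in [2^(2^nat)], the return times
[{g | z (f g) a = z f a + s a for f in F, a in A}] form a syndetic set. Each of
these filter bases (one for every [s]) is then contained in an element [p_s] of
[L]; the idempotent [u] can be chosen for [s = 0], and the products [u p_s] are
pairwise distinct elements of [uL].

The function [z] is a limit of points of a decreasing sequence of subshifts in
which far apart patterns can be glued freely; at each step the subshift is cut
down to the configurations in which a pattern [F] of the current point, up to a
translation of its values, occurs around every point of some maximal separated
set. As a pattern contains beforehand the translates of a smaller one by
finitely many values, these translates recur syndetically. *)

From Stdlib Require Import List PeanoNat Lia.
From mathcomp Require Import ssreflect ssrfun ssrbool.
From mathcomp Require Import boolp classical_sets filter functions cardinality.
Require Import Defs.

Set Implicit Arguments.
Unset Strict Implicit.
Unset Printing Implicit Defensive.

Local Open Scope classical_set_scope.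

Local Notation "x ** y" := (gmul _ x y) (at level 40, left associativity).
Local Notation inv x := (ginv _ x).

(** * Recurrent configurations *)

Section GroupTheory.
Variable G : group.
Implicit Types x y : G.

Lemma gmulK x y : inv x ** (x ** y) = y.
Proof. by rewrite gmulA gmulV gmul1. Qed.

Lemma gmulrV x : x ** inv x = gone G.
Proof.
by rewrite -[x ** _](gmulK (inv x)) [inv x ** (x ** _)]gmulK gmulV.
Qed.

Lemma gmulr1 x : x ** gone G = x.
Proof. by rewrite -(gmulV _ x) gmulA gmulrV gmul1. Qed.

Lemma gmulVK x y : x ** (inv x ** y) = y.
Proof. by rewrite gmulA gmulrV gmul1. Qed.

Lemma gmulI x y z : x ** z = y ** z -> x = y.
Proof. by move=> e; rewrite -[x]gmulr1 -[y]gmulr1 -(gmulrV z) !gmulA e. Qed.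

Lemma ginvM x y : inv (x ** y) = inv y ** inv x.
Proof.
by apply: (@gmulI _ _ (x ** y)); rewrite gmulV -gmulA gmulK gmulV.
Qed.

Lemma ginvK x : inv (inv x) = x.
Proof. by apply: (@gmulI _ _ (inv x)); rewrite gmulV gmulrV. Qed.

End GroupTheory.

Ltac gsimp := rewrite ?ginvM ?ginvK; rewrite -?gmulA;
  rewrite ?(gmulK, gmulVK, gmulV, gmulrV, gmul1, gmulr1).

(** * Right-invariant closeness in the group and maximal separated sets *)

Section Near.
Variable G : group.
Implicit Types (A B D E : list G) (a b c g : G).

Definition mulL A B := flat_map (fun a => map (fun b => a ** b) B) A.
Definition invL A := map (fun a => inv a) A.

Definition near D a b := exists2 d, In d D & b = d ** a.

Lemma in_mulL a b A B : In a A -> In b B -> In (a ** b) (mulL A B).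
Proof.
move=> aA bB; apply/in_flat_map; exists a; split=> //.
by apply/in_map_iff; exists b.
Qed.

Lemma near_trans A B a b c : near B a b -> near A b c -> near (mulL A B) a c.
Proof.
move=> [d dB ->] [e eA ->]; exists (e ** d); first exact: in_mulL.
by rewrite gmulA.
Qed.

Lemma near_sym A a b : near A a b -> near (invL A) b a.
Proof.
move=> [d dA ->]; exists (inv d); last by gsimp.
by apply/in_map_iff; exists d.
Qed.

Lemma near_incl A B a b : List.incl A B -> near A a b -> near B a b.
Proof. by move=> AB [d dA e]; exists d => //; apply: AB. Qed.

Lemma near_mulr A g a b : near A a b -> near A (a ** g) (b ** g).
Proof. by move=> [d dA ->]; exists d => //; rewrite gmulA. Qed.

Lemma near_mul A f c : In f A -> near A c (f ** c).
Proof. by move=> fA; exists f. Qed.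

Lemma near_app A B a b : near (A ++ B) a b <-> near A a b \/ near B a b.
Proof.
split; first by move=> [d /in_app_iff[?|?] ->]; [left|right]; exists d.
by case; apply: near_incl => x xA; apply/in_app_iff; [left|right].
Qed.

Definition separated E (C : set G) :=
  forall c c', C c -> C c' -> near E c c' -> c = c'.

(** [near E] need be neither reflexive nor symmetric; a maximal [E]-separated set is dense only for
    this symmetrized version. *)
Definition nbd E := (gone G :: nil) ++ E ++ invL E.

Lemma maximal_separated E (C0 : set G) : separated E C0 ->
  exists C, [/\ C0 `<=` C, separated E C &
    forall h, exists2 c, C c & near (nbd E) c h].
Proof.
move=> sep0.
(* Zorn's lemma runs over the sets to be added to [C0], so that the empty chain is settled by
   [sep0]. *)
have chains : forall F : set (set G),
    F `<=` (fun C => separated E (C0 `|` C)) -> total_on F subset ->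
    separated E (C0 `|` \bigcup_(X in F) X).
  move=> F Fsep Ftot c c' [C0c|[X FX Xc]] [C0c'|[X' FX' Xc']] n.
  - exact: sep0.
  - by apply: (Fsep _ FX') n; [left|right].
  - by apply: (Fsep _ FX) n; [right|left].
  - have [XX'|X'X] := Ftot _ _ FX FX'.
    + by apply: (Fsep _ FX') n; right=> //; apply: XX'.
    + by apply: (Fsep _ FX) n; right=> //; apply: X'X.
have [C [sepC maxC]] := Zorn_bigcup chains.
exists (C0 `|` C); split=> // h.
apply: contrapT => far.
have {}far c : (C0 `|` C) c -> ~ near E c h /\ ~ near E h c /\ c <> h.
  move=> Cc; split=> [n|]; last split=> [n|e]; apply: far; exists c => //;
    apply/near_app.
  - by right; apply/near_app; left.
  - by right; apply/near_app; right; apply: near_sym.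
  - by left; exists (gone G); [left|rewrite gmul1].
apply: (maxC (C `|` [set h])).
  split=> [x|]; first by left.
  by move=> /(_ h) Ch; have [|_ []] := far h; [right; apply: Ch; right|].
move=> c c' Cc Cc' n.
have {}Cc : (C0 `|` C) c \/ c = h.
  by case: Cc => [|[|]] Cc; [left; left|left; right|right].
have {}Cc' : (C0 `|` C) c' \/ c' = h.
  by case: Cc' => [|[|]] Cc'; [left; left|left; right|right].
case: Cc => [Cc|eh]; case: Cc' => [Cc'|eh'].
- exact: sepC n.
- by subst c'; case: (far c Cc).
- by subst c; case: (far c' Cc') => _ [].
- by subst.
Qed.

End Near.

(** * Flexible sets of configurations and the passage to a limit *)

Section Configurations.
Variables G K : group.
Implicit Types (Y : set (G -> K)) (y z : G -> K) (F : list G).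

Definition rot (g : G) y : G -> K := fun h => y (h ** g).
Definition flip (k : K) y : G -> K := fun h => y h ** k.

(* [R b] is the set of configurations whose value at [b] is prescribed; only
   prescriptions at [D]-far points may come from different configurations. *)
Definition gluing Y := exists D : list G, forall R : G -> set (G -> K),
  (forall b, R b `<=` Y) ->
  (forall b y b' y', R b y -> R b' y' -> near D b b' -> y = y') ->
  exists2 y, Y y & forall b y', R b y' -> y b = y' b.

(** No closure under pointwise limits is asked: what the final limit must satisfy is tested on
    finite windows. *)
Definition flexible Y := [/\ forall g y, Y y -> Y (rot g y),
  forall k y, Y y -> Y (flip k y) & gluing Y].

Lemma flexible_setT : flexible setT.
Proof.
split=> //; exists (gone G :: nil) => R _ Rn.
have /choice[y yP] : forall b, exists k, forall y', R b y' -> k = y' b.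
  move=> b; have [[y' Ry']|nR] := pselect (exists y', R b y').
    exists (y' b) => y'' Ry''; congr (_ b); apply: Rn Ry' Ry'' _.
    by exists (gone G); [left|rewrite gmul1].
  by exists (gone K) => y' Ry'; case: nR; exists y'.
by exists y.
Qed.

Hypothesis infG : infinite_type G.

(** One [k] at a time: as [G] is infinite, some [w] puts the translate of [F] by [w] far from the
    finite part [F'] already fixed, and a copy of [z] with values translated by [k] is glued
    there. *)
Lemma insert_translates Y z F (Ks : list K) : flexible Y -> Y z ->
  exists z1 F' W, [/\ Y z1, List.incl F F', forall f, In f F -> z1 f = z f &
    forall k, In k Ks -> exists2 w, In w W &
      forall f, In f F -> In (f ** w) F' /\ z1 (f ** w) = z f ** k].
Proof.
move=> [Yrot Yflip [D glueD]] Yz.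
elim: Ks => [|k Ks [z1 [F' [W [Yz1 FF' z1z W1]]]]].
  by exists z, F, nil; split=> // x.
have [w wP] := infG (mulL (invL F) (mulL (D ++ invL D) F')).
have far f a : In f F -> In a F' -> near (D ++ invL D) a (f ** w) -> False.
  move=> fF aF' [d dD e]; apply: wP.
  have -> : w = inv f ** (d ** a) by rewrite -e; gsimp.
  by apply: in_mulL; [apply/in_map_iff; exists f|apply: in_mulL].
pose R b := [set y | (In b F' /\ y = z1) \/
  (exists2 f, In f F & b = f ** w /\ y = flip k (rot (inv w) z))].
have [z2 Yz2 z2P] : exists2 y, Y y & forall b y', R b y' -> y b = y' b.
  apply: glueD => [b y [[_ ->]//|[f _ [_ ->]]]|].
    by apply: Yflip; apply: Yrot.
  move=> b y b' y' [[bF ->]|[f fF [-> ->]]] [[bF' ->]|[f' fF' [-> ->]]] n //.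
  - by case: (far _ _ fF' bF); apply/near_app; left.
  - by case: (far _ _ fF bF'); apply/near_app; right; apply: near_sym.
exists z2, (F' ++ map (fun f => f ** w) F), (w :: W); split=> //.
- by move=> f fF; apply/in_app_iff; left; apply: FF'.
- by move=> f fF; rewrite -z1z //; apply: z2P; left; split=> //; apply: FF'.
- move=> k' [<-|/W1[w' w'W w'P]].
    exists w; first by left.
    move=> f fF; split.
      by apply/in_app_iff; right; apply/in_map_iff; exists f.
    rewrite (z2P _ (flip k (rot (inv w) z))); last by right; exists f.
    by rewrite /flip /rot; gsimp.
  exists w'; first by right.
  move=> f fF; have [fw' <-] := w'P f fF; split; first by apply/in_app_iff; left.
  by apply: z2P; left.
Qed.

Definition repeats z F E y (C : set G) := [/\ separated E C,
  forall h, exists2 c, C c & near (nbd E) c h &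
  forall c, C c -> exists s, forall f, In f F -> y (f ** c) = z f ** s].

Lemma repeats_rot z F E y C g :
  repeats z F E y C -> repeats z F E (rot g y) [set c | C (c ** g)].
Proof.
move=> [sep cov rep]; split.
- move=> c c' Cc Cc' n; apply: (@gmulI _ _ _ g); apply: sep => //.
  exact: near_mulr.
- move=> h; have [c Cc n] := cov (h ** g).
  exists (c ** inv g); first by rewrite /mkset; move: Cc; gsimp.
  by move: (near_mulr (inv g) n); rewrite -(gmulA _ h) gmulrV gmulr1.
- move=> c /rep[s sP]; exists s => f fF; by rewrite /rot -gmulA sP.
Qed.

Lemma repeats_flip z F E y C k :
  repeats z F E y C -> repeats z F E (flip k y) C.
Proof.
move=> [sep cov rep]; split=> // c /rep[s sP]; exists (s ** k) => f fF.
by rewrite /flip sP // gmulA.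
Qed.

(** * Configurations in which a pattern recurs around a separated dense set of centres *)

Section Cells.
Variables (Y : set (G -> K)) (z : G -> K) (F D : list G).
Hypothesis Yrot : forall g y, Y y -> Y (rot g y).
Hypothesis Yflip : forall k y, Y y -> Y (flip k y).
Hypothesis glueD : forall R : G -> set (G -> K), (forall b, R b `<=` Y) ->
  (forall b y b' y', R b y -> R b' y' -> near D b b' -> y = y') ->
  exists2 y, Y y & forall b y', R b y' -> y b = y' b.
Hypothesis Yz : Y z.

(** Chosen so that distinct centres of an [E]-separated set carry cells that are [D]-far from each
    other, hence can be filled independently. *)
Let E := mulL (invL F) (mulL D F).

Let near_cells f c f' c' : In f F -> In f' F ->
  near D (f ** c) (f' ** c') -> near E c c'.
Proof.
move=> fF f'F [d dD e]; exists (inv f' ** (d ** f)).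
  by apply: in_mulL; [apply/in_map_iff; exists f'|apply: in_mulL].
by rewrite -!gmulA [d ** (f ** c)]gmulA -gmulA -e; gsimp.
Qed.

Let cell (C : set G) b y :=
  exists c f, [/\ C c, In f F, b = f ** c & y = rot (inv c) z].

Let cellY C b y : cell C b y -> Y y.
Proof. by move=> [c [f [_ _ _ ->]]]; apply: Yrot. Qed.

Let cell_val C y c f : (forall b y', cell C b y' -> y b = y' b) ->
  C c -> In f F -> y (f ** c) = z f.
Proof.
move=> yC Cc fF; rewrite (yC _ (rot (inv c) z)); last by exists c, f.
by rewrite /rot; gsimp.
Qed.

Definition cells : set (G -> K) := [set y | Y y /\ exists C, repeats z F E y C].

Lemma cells_inhabited : exists2 y, cells y & forall f, In f F -> y f = z f.
Proof.
(* Having the unit among the centres makes the glued configuration agree with [z] on [F] itself. *)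
have [|C [C1 sepC covC]] := @maximal_separated G E [set gone G].
  by move=> c c' -> ->.
have [y Yy yC] : exists2 y, Y y & forall b y', cell C b y' -> y b = y' b.
  apply: glueD => [b y|]; first exact: cellY.
  move=> _ _ _ _ [c [f [Cc fF -> ->]]] [c' [f' [Cc' fF' -> ->]]] n.
  by rewrite (sepC c c') //; apply: near_cells n.
have yz c f : C c -> In f F -> y (f ** c) = z f by apply: cell_val.
exists y; last by move=> f fF; rewrite -(yz (gone G)) ?gmulr1 //; apply: C1.
split=> //; exists C; split=> // c Cc; exists (gone K) => f fF.
by rewrite yz // gmulr1.
Qed.

(** Around the prescribed points the centres of the prescribing configurations are kept ([C1]),
    together with their cells ([own]). These centres are completed to a maximal separated set, the
    pattern of [z] is written at the added ones ([new]), and everything is glued in [Y]. *)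
Lemma cells_gluing : gluing cells.
Proof.
(* The centres depend on [y] only, so prescriptions from the same configuration use the same
   separated set. *)
have /choice[Cof CofP] : forall y, exists C, cells y -> repeats z F E y C.
  move=> y; have [[_ [C CP]]|n] := pselect (cells y); first by exists C.
  by exists set0.
(* From a prescribed point [R] leads, through a [D]-close point of a cell and the centre of that
   cell, to a centre of the prescribing configuration. *)
pose R := mulL (invL (nbd E)) (mulL (invL F) (D ++ invL D)).
(* In order: two prescribed points; separation of [C1]; one centre kept on behalf of two prescribed
   points; a prescribed point and a kept cell, in both directions. *)
exists (D ++ mulL (invL R) (mulL E R) ++ mulL (invL R) R ++
  mulL (invL (mulL F R)) D ++ mulL D (mulL F R)) => A Acells An.
pose C1 c := exists a y, [/\ A a y, near R a c & Cof y c].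
have sepC1 : separated E C1.
  move=> c c' [a [y [Aa ac yc]]] [a' [y' [Aa' ac' yc']]] n.
  have e : y = y'.
    apply: An Aa Aa' _; apply/near_app; right; apply/near_app; left.
    by apply: near_trans (near_sym ac'); apply: near_trans n.
  subst y'; have [sep _ _] := CofP _ (Acells _ _ Aa); exact: sep n.
have [C [C1C sepC covC]] := maximal_separated sepC1.
pose own b y :=
  exists c f a, [/\ A a y, near R a c & Cof y c] /\ In f F /\ b = f ** c.
pose new := C `\` C1.
have ownC c a y : [/\ A a y, near R a c & Cof y c] -> C1 c.
  by move=> ?; exists a, y.
have A_own b y b' y' : A b y -> own b' y' -> near D b b' \/ near D b' b -> y = y'.
  move=> Ab [c [f [a [[Aa ac yc] [fF ->]]]]].
  have af : near (mulL F R) a (f ** c) by apply: near_trans ac (near_mul _ fF).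
  case=> n.
    apply: An Ab Aa _; do 3![apply/near_app; right]; apply/near_app; left.
    by apply: near_trans n (near_sym af).
  apply/esym; apply: An Aa Ab _; do 4![apply/near_app; right].
  exact: near_trans af n.
(* A centre of [y] lies close to any new centre near [b], hence in [C1],
   against the separation of [C]. *)
have A_new b y b' y' : A b y -> cell new b' y' ->
    near D b b' \/ near D b' b -> False.
  move=> Ab [c [f [[Cc nC1] fF -> _]]] n.
  have [_ covy _] := CofP _ (Acells _ _ Ab); have [c' yc' cc'] := covy c.
  have C1c' : C1 c'.
    exists b, y; split=> //; apply: near_trans (near_sym cc').
    apply: near_trans (near_sym (near_mul c fF)).
    by apply/near_app; case: n => n; [left|right; apply: near_sym].
  suff e : c' = c by apply: nC1; rewrite -e.
  case/near_app: cc' => [[d [<-|[]] ->]|/near_app[n'|n']].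
  - by rewrite gmul1.
  - by apply: sepC n' => //; apply: C1C.
  - apply/esym; apply: sepC => //; first exact: C1C.
    move: (near_sym n'); rewrite /invL map_map.
    by under map_ext do rewrite ginvK; rewrite map_id.
pose R2 b := [set y | A b y \/ own b y \/ cell new b y].
have [y Yy yR2] : exists2 y, Y y & forall b y', R2 b y' -> y b = y' b.
  apply: glueD.
    move=> b y [/Acells[]//|[[c [f [a [[/Acells[]//]]]]]|]]; exact: cellY.
  move=> b y b' y' [Ab|[ob|nb]] [Ab'|[ob'|nb']] n.
  - by apply: An Ab Ab' _; apply/near_app; left.
  - by apply: A_own Ab ob' _; left.
  - by case: (A_new _ _ _ _ Ab nb'); left.
  - by apply/esym; apply: A_own Ab' ob _; right.
  - move: ob ob' n => [c [f [a [P [fF ->]]]]] [c' [f' [a' [P' [fF' ->]]]]] n.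
    have e : c = c'.
      apply: sepC (near_cells fF fF' n); apply: C1C; first exact: ownC P.
      exact: ownC P'.
    subst c'; case: P P' => Aa ac _ [Aa' ac' _].
    apply: An Aa Aa' _; do 2![apply/near_app; right]; apply/near_app; left.
    exact: near_trans ac (near_sym ac').
  - move: ob nb' n => [c [f [a [P [fF ->]]]]] [c' [f' [[Cc' nC1] fF' -> ->]]] n.
    case: nC1; rewrite -(sepC _ _ _ Cc' (near_cells fF fF' n)).
      exact: ownC P.
    by apply: C1C; apply: ownC P.
  - by case: (A_new _ _ _ _ Ab' nb); right.
  - move: nb ob' n => [c [f [[Cc nC1] fF -> ->]]] [c' [f' [a [P [fF' ->]]]]] n.
    case: nC1; rewrite (sepC _ _ Cc _ (near_cells fF fF' n)).
      exact: ownC P.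
    by apply: C1C; apply: ownC P.
  - move: nb nb' n => [c [f [[Cc _] fF -> ->]]] [c' [f' [[Cc' _] fF' -> ->]]] n.
    by rewrite (sepC c c') //; apply: near_cells n.
exists y; last by move=> b y' Ab; apply: yR2; left.
split=> //; exists C; split=> // c Cc.
have [[a [y' [Aa ac yc]]]|nC1] := pselect (C1 c).
  have [_ _ rep] := CofP _ (Acells _ _ Aa).
  have [s sP] := rep _ yc; exists s => f fF; rewrite -sP //.
  by apply: yR2; right; left; exists c, f, a.
exists (gone K) => f fF; rewrite gmulr1; apply: (@cell_val new) => //.
by move=> b y' ?; apply: yR2; right; right.
Qed.

Lemma cells_flexible : flexible cells.
Proof.
split; last exact: cells_gluing.
- move=> g y [Yy [C CP]]; split; first exact: Yrot.
  by exists [set c | C (c ** g)]; apply: repeats_rot.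
- move=> k y [Yy [C CP]]; split; first exact: Yflip.
  by exists C; apply: repeats_flip.
Qed.

Lemma cells_dense y h : cells y -> exists2 e, In e (invL (nbd E)) &
  exists s, forall f, In f F -> y (f ** (e ** h)) = z f ** s.
Proof.
move=> [_ [C [_ cov rep]]]; have [c Cc /near_sym[e eE ce]] := cov h.
by exists e => //; rewrite -ce; apply: rep.
Qed.

End Cells.

(** The uncontrolled translation [s] depends on [h] but not on [k], so a later choice of [k] can
    compensate for it. *)
Definition recurs z F (Ks : list K) (T : list G) y := forall h, exists s,
  forall k, In k Ks -> exists2 t, In t T &
    forall f, In f F -> y (f ** t ** h) = z f ** k ** s.

(** The enlarged pattern [F'] already contains [F] translated by every value in [Ks]. Once [F']
    recurs up to some [s], all these copies recur with the same [s], at the times [w ** e]. *)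
Lemma refine Y z F (Ks : list K) : flexible Y -> Y z ->
  exists Y' z', [/\ flexible Y' /\ Y' z', Y' `<=` Y,
    forall f, In f F -> z' f = z f &
    exists T, forall y, Y' y -> recurs z F Ks T y].
Proof.
move=> flexY Yz.
have [z1 [F' [W [Yz1 FF' z1z W1]]]] := insert_translates F Ks flexY Yz.
have [Yrot Yflip [D glueD]] := flexY.
have [z' cz' z'z1] := cells_inhabited F' Yrot glueD Yz1.
exists (cells Y z1 F' D), z'; split.
- by split=> //; exact: (cells_flexible F' Yrot Yflip glueD Yz1).
- by move=> y [].
- by move=> f fF; rewrite z'z1 ?z1z //; apply: FF'.
- exists (mulL W (invL (nbd (mulL (invL F') (mulL D F'))))) => y cy h.
  have [e eE [s sP]] := cells_dense h cy.
  exists s => k /W1[w wW wP]; exists (w ** e); first exact: in_mulL.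
  move=> f /wP[fw <-]; rewrite -sP //; congr y; by gsimp.
Qed.

Lemma countable_enum : countable_type G ->
  exists Fs : nat -> list G,
    (forall m n, m <= n -> List.incl (Fs m) (Fs n)) /\
    (forall F, exists n, List.incl F (Fs n)).
Proof.
move=> [code codeI].
have /choice[en enP] : forall n, exists g, forall g', code g' = n -> g = g'.
  move=> n; have [[g gn]|no] := pselect (exists g, code g = n).
    by exists g => g' g'n; apply: codeI; rewrite gn.
  by exists (gone G) => g' g'n; case: no; exists g'.
exists (fun n => map en (seq 0 n)); split.
  move=> m n mn g /in_map_iff[i [<- /in_seq im]]; apply/in_map_iff.
  by exists i; split=> //; apply/in_seq; lia.
elim=> [|g F [n nP]]; first by exists 0.
exists (S (Nat.max n (code g))) => g' [<-|/nP/in_map_iff[i [<- /in_seq im]]].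
  by apply/in_map_iff; exists (code g); split; [apply: enP|apply/in_seq; lia].
by apply/in_map_iff; exists i; split=> //; apply/in_seq; lia.
Qed.

Theorem recurrent_configuration (Kn : nat -> list K) : countable_type G ->
  exists z : G -> K, forall n F, exists T, recurs z F (Kn n) T z.
Proof.
move=> /countable_enum[Fs [Fs_mono Fs_exh]].
pose Ks n := flat_map Kn (seq 0 (S n)).
pose stage := {p : set (G -> K) * (G -> K) | flexible p.1 /\ p.1 p.2}.
pose step (n : nat) (a b : stage) := [/\ (sval b).1 `<=` (sval a).1,
  forall f, In f (Fs n) -> (sval b).2 f = (sval a).2 f &
  exists T, forall y, (sval b).1 y -> recurs (sval a).2 (Fs n) (Ks n) T y].
have /choice[next nextP] : forall na : nat * stage, exists b, step na.1 na.2 b.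
  move=> [n [[Y z] [/= flexY Yz]]].
  have [Y' [z' [Y'z' ? ? ?]]] := refine (Fs n) (Ks n) flexY Yz.
  by exists (exist _ (Y', z') Y'z'); split.
pose st0 : stage := exist _ (setT, fun=> gone K) (conj flexible_setT I).
pose st := nat_rect (fun=> stage) st0 (fun n a => next (n, a)).
have stP n : step n (st n) (st (S n)) by exact: (nextP (n, st n)).
pose Y n := (sval (st n)).1; pose z n := (sval (st n)).2.
have Ydec m n : m <= n -> Y n `<=` Y m.
  elim=> [//|{}n _ IH] y Yy; apply: IH.
  by have [sub _ _] := stP n; apply: sub.
have zst m n f : m <= n -> In f (Fs m) -> z n f = z m f.
  move=> mn fm; elim: mn => [//|{}n mn <-].
  have [_ e _] := stP n; apply: e; exact: Fs_mono mn _ fm.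
have /choice[rk rkP] : forall g, exists n, In g (Fs n).
  by move=> g; have [n nP] := Fs_exh (g :: nil); exists n; apply: nP; left.
pose zz g := z (rk g) g.
have zzE n f : In f (Fs n) -> zz f = z n f.
  move=> fn; rewrite /zz; have [le|le] := Nat.le_ge_cases (rk f) n.
    by apply/esym; apply: zst.
  exact: zst.
(* Stage [m] is late enough for [Fs m] to contain [F] and for [Ks m] to contain [Kn n]. *)
exists zz => n F; have [m0 m0P] := Fs_exh F; pose m := Nat.max n m0.
have FFm : List.incl F (Fs m).
  by move=> f /m0P; apply: Fs_mono; rewrite /m; lia.
have [_ _ [T TP]] := stP m; exists T => h.
have [m1 m1P] := Fs_exh (flat_map (fun f => map (fun t => f ** t ** h) T) F).
(* The limit [zz] need not lie in any [Y n]. For a given [h] only finitely many values matter; on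
   them [zz] equals [z m2], which lies in [Y (S m)]. *)
pose m2 := Nat.max (S m) m1.
have [|s sP] := TP (z m2) _ h.
  apply: (Ydec _ m2); first by rewrite /m2; lia.
  exact: (svalP (st m2)).2.
exists s => k kn; have [|t tT tP] := sP k.
  by apply/in_flat_map; exists n; split=> //; apply/in_seq; rewrite /m; lia.
exists t => // f fF; rewrite (zzE m2) ?(zzE m) ?tP //; try exact: FFm.
apply: (Fs_mono m1); first by rewrite /m2; lia.
by apply: m1P; apply/in_flat_map; exists f; split=> //; apply/in_map_iff; exists t.
Qed.

End Configurations.

(** * Recurrence with values in the Boolean group of functions on the Cantor space *)

Section Signs.

Definition cantor := nat -> bool.

Lemma xorA (a b c : cantor -> bool) :
  (fun x => xorb (a x) (xorb (b x) (c x))) =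
  (fun x => xorb (xorb (a x) (b x)) (c x)).
Proof. by apply/funext => x; rewrite Bool.xorb_assoc. Qed.

Lemma xor0 (a : cantor -> bool) : (fun x => xorb false (a x)) = a.
Proof. by apply/funext => x; case: (a x). Qed.

Lemma xorN (a : cantor -> bool) : (fun x => xorb (a x) (a x)) = (fun=> false).
Proof. by apply/funext => x; case: (a x). Qed.

Definition signs : group :=
  @Group _ (fun a b x => xorb (a x) (b x)) _ (fun a => a) xorA xor0 xorN.

Fixpoint clopens n : list (cantor -> bool) :=
  if n is S m then
    flat_map (fun u => map (fun v (x : cantor) =>
      if x 0 then u (fun i => x (S i)) else v (fun i => x (S i))) (clopens m))
      (clopens m)
  else (fun=> false) :: (fun=> true) :: nil.

(** This is the separability of a product of continuum many two-point spaces: countably many finite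
    lists approximate every [s] on finitely many coordinates, so countably many stages serve all
    [s]. *)
Lemma clopens_interpolate n (A : set cantor) (s : cantor -> bool) :
  (forall a b, A a -> A b -> (forall i, i < n -> a i = b i) -> a = b) ->
  exists2 k, In k (clopens n) & forall a, A a -> k a = s a.
Proof.
elim: n A s => [|n IH] A s inj.
  have [[a Aa]|nA] := pselect (exists a, A a).
    exists (fun=> s a); first by case: (s a); [right; left|left].
    move=> b Ab; congr s; apply: inj => // i; lia.
  by exists (fun=> false); [left|move=> a Aa; case: nA; exists a].
pose cons b (x : cantor) : cantor := fun i => if i is S j then x j else b.
have consK a : cons (a 0) (fun i => a (S i)) = a by apply/funext => -[].
have IHb b : exists2 k, In k (clopens n) &
    forall a, A (cons b a) -> k a = s (cons b a).
  have [|k kn kP] := IH [set a | A (cons b a)] (fun a => s (cons b a)).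
    move=> x y Ax Ay xy; have e : cons b x = cons b y.
      by apply: inj => // -[|i] // ni; apply: xy; lia.
    by apply/funext => i; have := congr1 (fun z => z (S i)) e.
  by exists k.
have [[u un uP] [v vn vP]] := (IHb true, IHb false).
exists (fun x => if x 0 then u (fun i => x (S i)) else v (fun i => x (S i))).
  by apply/in_flat_map; exists u; split=> //; apply/in_map_iff; exists v.
move=> a Aa; case a0 : (a 0); [rewrite uP|rewrite vP];
  by rewrite -a0 consK.
Qed.

Lemma separating_prefix (A : list cantor) : exists n, forall a b,
  In a A -> In b A -> (forall i, i < n -> a i = b i) -> a = b.
Proof.
have /choice[N NP] : forall ab : cantor * cantor, exists n,
    (forall i, i < n -> ab.1 i = ab.2 i) -> ab.1 = ab.2.
  move=> [a b] /=; have [->|ab] := pselect (a = b); first by exists 0.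
  have [i iP] : exists i, a i <> b i.
    apply: contrapT => no; apply: ab; apply/funext => i.
    by apply: contrapT => ?; apply: no; exists i.
  by exists (S i) => /(_ i) e; case: iP; apply: e; lia.
exists (list_max (map N (list_prod A A))) => a b aA bA ab.
apply: (NP (a, b)) => /= i iN; apply: ab.
apply: Nat.lt_le_trans iN _.
have /list_max_le/Forall_forall := Nat.le_refl (list_max (map N (list_prod A A))).
by apply; apply/in_map_iff; exists (a, b); split=> //; apply/in_prod.
Qed.

Definition returns (G : group) (z : G -> cantor -> bool) F A (s : cantor -> bool) :
  set G := [set g | forall f a, In f F -> In a A ->
    z (f ** g) a = xorb (z f a) (s a)].

Theorem syndetic_returns (G : group) : countable_type G -> infinite_type G ->
  exists z : G -> cantor -> bool, forall F A s, exists T,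
    forall h, exists2 t, In t T & returns z F A s (t ** h).
Proof.
move=> ctblG infG.
have [z zP] := @recurrent_configuration G signs infG clopens ctblG.
exists z => F A s; have [n nP] := separating_prefix A.
have [T TP] := zP n F; exists T => h; have [c cP] := TP h.
(* [c] is the uncontrolled translation at [h]; a [k] equal to the sum of [s] and [c] on [A] cancels
   it. *)
have [k kn kP] := @clopens_interpolate n [set a | In a A] (fun a => xorb (s a) (c a)) nP.
have [t tT tP] := cP k kn; exists t => // f a fF aA.
rewrite gmulA tP //= kP //; by case: (z f a) (s a) (c a) => [] [] [].
Qed.

End Signs.

(** * The semigroup of ultrafilters *)

Section Beta.
Variable G : group.

Definition beta := {p : set_system G | UltraFilter p}.
Implicit Types (p q r : beta) (A B : set G) (C : set beta).

Lemma betaT p : sval p setT.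
Proof. by case: p => p [pf _] /=; apply: filterT. Qed.

Lemma betaI p A B : sval p A -> sval p B -> sval p (A `&` B).
Proof. by case: p => p [pf _] /=; apply: filterI. Qed.

Lemma betaS p A B : A `<=` B -> sval p A -> sval p B.
Proof. by case: p => p [pf _] /=; apply: filterS. Qed.

Lemma betaE p A : sval p A -> exists x, A x.
Proof. by case: p => p [pf _] /=; apply: filter_ex. Qed.

Lemma betaC p A : ~ sval p A -> sval p (~` A).
Proof. by case: p => p pu /=; have [] := in_ultra_setVsetC A pu. Qed.

Lemma betaNC p A : sval p A -> sval p (~` A) -> False.
Proof. by move=> pA pCA; have [x []] := betaE (betaI pA pCA). Qed.

Lemma beta_eq p q : (forall A, sval p A -> sval q A) -> p = q.
Proof.
case: p q => p pu [q qu] /= pq; have e : q = p by apply: max_filter.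
by subst q; congr exist; apply: Prop_irrelevance.
Qed.

Lemma betaN_In p T (X : T -> set G) l : (forall x, In x l -> ~ sval p (X x)) ->
  ~ sval p [set g | exists2 x, In x l & X x g].
Proof.
elim: l => [_ /betaE[g []]//|x l IH notX pX].
have pnX : sval p (~` X x) by apply: betaC; apply: notX; left.
apply: IH (betaS _ (betaI pX pnX)) => [y yl|]; first by apply: notX; right.
by move=> g [[y [<-|yl]] // Xy _]; exists y.
Qed.

Lemma ultrafilterP (F : set_system G) : ProperFilter F ->
  (forall A, F A \/ F (~` A)) -> UltraFilter F.
Proof.
move=> FF FC; split=> // H HF FH; apply/seteqP; split=> // A HA.
have [//|/FH HnA] := FC A; case: (@filter_not_empty _ H _).
by rewrite -(setICr A); apply: filterI.
Qed.

Definition directed_down (D : set (set G)) := (exists A, D A) /\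
  forall A B, D A -> D B -> exists2 E, D E & E `<=` A `&` B.

(** Closedness in the Stone topology, whose basic open sets consist of the ultrafilters containing a
    given set. *)
Definition beta_closed C :=
  forall p, (forall A, sval p A -> exists2 q, C q & sval q A) -> C p.

(** Extend to an ultrafilter the filter generated by [D] and the sets common to all members of [C].
    If it were not in [C], the complement of one of its sets would be common to all members of
    [C]. *)
Lemma beta_compact C (D : set (set G)) : beta_closed C -> directed_down D ->
  (forall A, D A -> exists2 q, C q & sval q A) ->
  exists2 p, C p & forall A, D A -> sval p A.
Proof.
move=> clC [[A0 DA0] Dd] DC.
pose I := [set x : set G * set G | D x.1 /\ forall q, C q -> sval q x.2].
have FF : ProperFilter (filter_from I (fun x => x.1 `&` x.2)).
  apply: filter_from_proper; first apply: filter_from_filter.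
  - by exists (A0, setT); split=> //= q _; apply: betaT.
  - move=> [A E] [A' E'] /= [DA CE] [DA' CE'].
    have [A'' DA'' sub] := Dd _ _ DA DA'.
    exists (A'', E `&` E') => /=.
      by split=> //= q Cq; apply: betaI; [apply: CE|apply: CE'].
    by move=> g [/sub[? ?] [? ?]].
  - move=> [A E] /= [/DC[q Cq qA] CE]; apply: (@betaE q).
    by apply: betaI => //; apply: CE.
have [p [pu Fp]] := ultraFilterLemma FF.
exists (exist _ p pu); last first.
  move=> A DA; apply: Fp; exists (A, setT) => /=; last by move=> g [].
  by split=> // q _; apply: betaT.
apply: clC => A /= pA; apply: contrapT => no.
apply: (@betaNC (exist _ p pu) A) => //=; apply: Fp; exists (A0, ~` A) => /=.
  by split=> //= q Cq; apply: betaC => qA; apply: no; exists q.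
by move=> g [].
Qed.

Lemma bunit_ultra (g : G) : UltraFilter [set A : set G | A g].
Proof.
apply: ultrafilterP; last by move=> A; have [?|?] := pselect (A g); [left|right].
split; first by case.
by split=> // A B AB; apply: AB.
Qed.

Definition bunit g : beta := exist _ _ (bunit_ultra g).

Lemma bmul_ultra p q :
  UltraFilter [set A | sval p [set g | sval q [set h | A (g ** h)]]].
Proof.
apply: ultrafilterP => [|A].
  apply: Build_ProperFilter_ex => [A /betaE[g /betaE[h Agh]]|].
    by exists (g ** h).
  split.
  - by apply: betaS (betaT p) => g _; apply: betaS (betaT q).
  - move=> A B pA pB; apply: betaS (betaI pA pB) => g [qA qB].
    exact: betaI.
  - by move=> A B AB; apply: betaS => g; apply: betaS => h; apply: AB.
have [|/betaC npA] := pselect (sval p [set g | sval q [set h | A (g ** h)]]).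
  by left.
by right; apply: betaS npA => g; apply: betaC.
Qed.

(** In this order of the quantifiers the product is continuous in [p] for fixed [q]. *)
Definition bmul p q : beta := exist _ _ (bmul_ultra p q).

Lemma bmulA p q r : bmul p (bmul q r) = bmul (bmul p q) r.
Proof.
apply: beta_eq => A /=; apply: betaS => g; apply: betaS => h; apply: betaS => k.
by rewrite /= gmulA.
Qed.

Lemma bunit1 p : bmul (bunit (gone G)) p = p.
Proof. by apply: beta_eq => A /=; apply: betaS => h; rewrite /= gmul1. Qed.

Lemma bunitM g h : bunit (g ** h) = bmul (bunit g) (bunit h).
Proof. exact: beta_eq. Qed.

Definition left_invariant C := forall g p, C p -> C (bmul (bunit g) p).

(** Principal ultrafilters are dense and the product is continuous in its left factor. *)
Lemma invariant_ideal C p q : beta_closed C -> left_invariant C ->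
  C q -> C (bmul p q).
Proof.
move=> clC invC Cq; apply: clC => A /(@betaE p)[g qA].
by exists (bmul (bunit g) q); [apply: invC|exact: qA].
Qed.

Lemma closed_image_mulr C q : beta_closed C ->
  beta_closed [set bmul p q | p in C].
Proof.
move=> clC r rP.
have [||p Cp pP] := @beta_compact C
    [set E | exists2 A, sval r A & E = [set g | sval q [set h | A (g ** h)]]] clC.
- split; first by eexists; exists setT; first exact: betaT.
  move=> _ _ [A rA ->] [B rB ->].
  exists [set g | sval q [set h | (A `&` B) (g ** h)]].
    by exists (A `&` B) => //; apply: betaI.
  by move=> g /= qAB; split; apply: betaS qAB => h [].
- by move=> _ [A rA ->]; have [_ [p Cp <-] pA] := rP _ rA; exists p.
exists p => //; apply/esym; apply: beta_eq => A rA.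
by apply: pP; exists A.
Qed.

(** Zorn's lemma for complements in [C0]; by compactness the intersection of a chain is nonempty.
    [P] will be left invariance, then stability under products. *)
Lemma minimal_closed (P : set (set beta)) C0 :
  (forall F : set (set beta), F `<=` P -> P (\bigcap_(X in F) X)) ->
  beta_closed C0 -> C0 !=set0 -> P C0 ->
  exists C, [/\ C `<=` C0, beta_closed C, C !=set0, P C &
    forall C', C' `<=` C -> beta_closed C' -> C' !=set0 -> P C' -> C `<=` C'].
Proof.
move=> PI clC0 C0n PC0.
pose Q C := [/\ beta_closed C, C !=set0 & P C].
have [F FQ Ftot|U [[clU nU PU] maxU]] := @Zorn_bigcup _ (fun U => Q (C0 `\` U)).
  (* [C0] is added so that the intersection is the right one also for the empty chain. *)
  pose F' := [set X | X = C0 \/ exists2 U, F U & X = C0 `\` U].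
  have F'Q X : F' X -> Q X by case=> [->|[U FU ->]]; [split|apply: FQ].
  have F'tot : total_on F' subset.
    move=> _ _ [->|[U FU ->]] [->|[U' FU' ->]].
    - by left.
    - by right=> p [].
    - by left=> p [].
    - have [UU'|UU'] := Ftot _ _ FU FU'; [right|left] => p [? np];
      by split=> // ?; apply: np; apply: UU'.
  have -> : C0 `\` \bigcup_(X in F) X = \bigcap_(X in F') X.
    apply/seteqP; split=> [p [Cp np] _ [->|[U FU ->]] //|p pP].
      by split=> // Up; apply: np; exists U.
    split; first by apply: pP; left.
    move=> [U FU Up]; have [] : (C0 `\` U) p by apply: pP; right; exists U.
    by [].
  split.
  - move=> p pP X F'X; have [clX _ _] := F'Q _ F'X; apply: clX => A /pP[q qP qA].
    by exists q => //; apply: qP.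
  - have [||p _ pP] := @beta_compact setT
        [set A | exists2 X, F' X & forall q, X q -> sval q A] (fun _ _ => Logic.I).
    + split; first by exists setT; exists C0; [left|move=> q _; apply: betaT].
      move=> A B [X FX XA] [Y FY YB]; have [XY|YX] := F'tot _ _ FX FY.
        exists (A `&` B) => //; exists X => // q Xq; apply: betaI; first exact: XA.
        by apply: YB; apply: XY.
      exists (A `&` B) => //; exists Y => // q Yq; apply: betaI; last exact: YB.
      by apply: XA; apply: YX.
    + by move=> A [X /F'Q[_ [q Xq] _] XA]; exists q => //; apply: XA.
    exists p => X F'X; have [clX _ _] := F'Q _ F'X; apply: clX => A pA.
    apply: contrapT => no; apply: betaNC pA _; apply: pP; exists X => // q Xq.
    by apply: betaC => qA; apply: no; exists q.
  - by apply: PI => X /F'Q[].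
exists (C0 `\` U); split=> // C' sub clC' nC' PC' p Cp; apply: contrapT => nC'p.
apply: (maxU (~` C')).
  split=> [q Uq C'q|sub']; first by have [] := sub _ C'q.
  by case: Cp => _; apply; apply: sub'.
have -> : C0 `\` ~` C' = C'.
  apply/seteqP; split=> [q [_ nn]|q C'q]; first exact: contrapT nn.
  by split; [have [] := sub _ C'q|].
by [].
Qed.

Definition minimal_ideal C := [/\ beta_closed C, C !=set0, left_invariant C &
  forall C', C' `<=` C -> beta_closed C' -> C' !=set0 -> left_invariant C' ->
    C `<=` C'].

Lemma minimal_ideal_ex : exists L, minimal_ideal L.
Proof.
have [||||L [_ clL nL invL minL]] := @minimal_closed left_invariant setT.
- by move=> F FP g p Fp X FX; apply: FP => //; apply: Fp.
- by [].
- by exists (bunit (gone G)).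
- by [].
by exists L; split.
Qed.

(** The Ellis-Numakura argument: in a minimal closed subsemigroup [C] containing [u], first [C u] is
    all of [C], then so is the closed subsemigroup of the [p] with [p u = u]. *)
Lemma idempotent_ex S : beta_closed S -> S !=set0 ->
  (forall p q, S p -> S q -> S (bmul p q)) -> exists2 u, S u & bmul u u = u.
Proof.
move=> clS nS mulS.
have [|C [CS clC [u Cu] mulC minC]] := @minimal_closed
    (fun C => forall p q, C p -> C q -> C (bmul p q)) S _ clS nS mulS.
  move=> F FP p q Fp Fq X FX; apply: FP => //; [exact: Fp|exact: Fq].
have CCu : C `<=` [set bmul p u | p in C].
  apply: minC => [_ [p Cp <-]|||_ _ [p Cp <-] [q Cq <-]].
  - exact: mulC.
  - exact: closed_image_mulr.
  - by exists (bmul u u), u.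
  - exists (bmul (bmul p u) q); last by rewrite bmulA.
    by apply: (mulC) => //; apply: mulC.
have fix_u : C `<=` [set p | C p /\ bmul p u = u].
  apply: minC => [p []//|p pP||p q [Cp pu] [Cq qu]].
  - have Cp : C p by apply: clC => A /pP[q [Cq _] qA]; exists q.
    split=> //; apply/esym; apply: beta_eq => A uA /=.
    apply: contrapT => /betaC /pP[q [_ qu] qA].
    by apply: betaNC _ qA; move: uA; rewrite -{1}qu.
  - by have [p Cp pu] := CCu _ Cu; exists p.
  - by split; [apply: mulC|rewrite -bmulA qu].
by exists u; [apply: CS|have [] := fix_u _ Cu].
Qed.

(** * Algebra of a minimal left ideal *)

Section MinimalIdeal.
Variable L : set beta.
Hypothesis minL : minimal_ideal L.

Lemma minimal_idealM p q : L q -> L (bmul p q).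
Proof. by case: minL => clL _ invL _; apply: invariant_ideal. Qed.

Lemma minimal_ideal_mulr p q : L p -> L q -> exists2 r, L r & bmul r q = p.
Proof.
case: minL => clL nL invL Lmin Lp Lq.
suff /(_ p Lp)[r Lr rq] : L `<=` [set bmul r q | r in L] by exists r.
apply: Lmin.
- by move=> _ [r Lr <-]; apply: minimal_idealM.
- exact: closed_image_mulr.
- by exists (bmul q q), q.
- by move=> g _ [r Lr <-]; exists (bmul (bunit g) r); [apply: invL|rewrite bmulA].
Qed.

Lemma minimal_ideal_mulru u p : L u -> bmul u u = u -> L p -> bmul p u = p.
Proof.
by move=> Lu uu Lp; have [r _ <-] := minimal_ideal_mulr Lp Lu; rewrite -bmulA uu.
Qed.

(** [uL] is a group with unit [u]: left inverses exist by minimality, and the left inverse of a left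
    inverse of [p] is [p]. *)
Lemma minimal_ideal_inv u p : L u -> bmul u u = u -> L p -> bmul u p = p ->
  exists r, [/\ L r, bmul u r = r, bmul r p = u & bmul p r = u].
Proof.
move=> Lu uu Lp up.
have inv x : L x -> bmul u x = x ->
    exists r, [/\ L r, bmul u r = r & bmul r x = u].
  move=> Lx ux; have [r Lr rx] := minimal_ideal_mulr Lu Lx.
  exists (bmul u r); split; first exact: minimal_idealM.
    by rewrite bmulA uu.
  by rewrite -bmulA rx.
have [r [Lr ur rp]] := inv p Lp up; exists r; split=> //.
have [r' [Lr' ur' r'r]] := inv r Lr ur.
suff -> : p = r' by [].
by rewrite -up -r'r -bmulA rp (minimal_ideal_mulru Lu).
Qed.

(** Finitely many left translates of a syndetic [A] cover [G], so one of them belongs to [q], and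
    the corresponding translate of [q] contains [A]. Compactness treats all of [D] at once. *)
Lemma minimal_ideal_syndetic (D : set (set G)) : directed_down D ->
  (forall A, D A -> exists T, forall h, exists2 t, In t T & A (t ** h)) ->
  exists2 p, L p & forall A, D A -> sval p A.
Proof.
case: minL => clL [q Lq] invL _ Dd Dsynd.
apply: beta_compact => // A /Dsynd[T TP].
have [[t tT qA]|no] := pselect (exists2 t, In t T & sval q [set h | A (t ** h)]).
  by exists (bmul (bunit t) q); [apply: invL|exact: qA].
have := @betaN_In q _ (fun t => [set h | A (t ** h)]) T _.
case=> [t tT qA|]; first by apply: no; exists t.
by apply: betaS (betaT q) => h _; apply: TP.
Qed.

End MinimalIdeal.

(* [u] is taken in the closed semigroup of the ultrafilters [p] of [L] containing
   the returns of [z], and [q s] is the product by [u] of an ultrafilter of [L]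
   containing the returns up to [s]. *)
Lemma signed_elements (L : set beta) : minimal_ideal L ->
  countable_type G -> infinite_type G ->
  exists (u : beta) (q : (cantor -> bool) -> beta),
    [/\ L u, bmul u u = u, injective q & forall s, L (q s) /\ bmul u (q s) = q s].
Proof.
move=> minL ctblG infG.
have [z zsynd] := syndetic_returns ctblG infG.
pose D s := [set B | exists F X, B = returns z F X s].
have Dd s : directed_down (D s).
  split; first by exists (returns z nil nil s), nil, nil.
  move=> _ _ [F [X ->]] [F' [X' ->]].
  exists (returns z (F ++ F') (X ++ X') s); first by exists (F ++ F'), (X ++ X').
  move=> g gP; split=> f a fF aA; apply: gP; apply/in_app_iff; by [left|right].
have DM s p q : (forall B, D (fun=> false) B -> sval p B) ->
    (forall B, D s B -> sval q B) -> forall B, D s B -> sval (bmul p q) B.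
  move=> pD qD _ [F [X ->]].
  have pB : sval p (returns z F X (fun=> false)) by apply: pD; exists F, X.
  apply: betaS pB => g gP /=.
  (* After a return [g] of [F], the window to be returned by [h] is [F] moved by [g]. *)
  have qB : sval q (returns z (map (fun f => f ** g) F) X s).
    by apply: qD; exists (map (fun f => f ** g) F), X.
  apply: betaS qB => h hP f a fF aA.
  rewrite gmulA hP //; last by apply/in_map_iff; exists f.
  by rewrite gP //; case: (z f a).
have exL s : exists p, L p /\ forall B, D s B -> sval p B.
  have [|p Lp pD] := minimal_ideal_syndetic minL (Dd s); last by exists p.
  by move=> _ [F [X ->]]; apply: zsynd.
have /choice[q qP] := exL.
have [||| u [Lu uD] uu] :=
    @idempotent_ex [set p | L p /\ forall B, D (fun=> false) B -> sval p B].
- case: minL => clL _ _ _ p pP; split.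
    by apply: clL => X /pP[r [Lr _] rA]; exists r.
  move=> B DB; apply: contrapT => /betaC /pP[r [_ rD]].
  by apply: betaNC; apply: rD.
- by have [p pP] := exL (fun=> false); exists p.
- move=> p p' [Lp pD] [Lp' p'D]; split; first exact: minimal_idealM.
  exact: DM.
exists u, (fun s => bmul u (q s)); split=> //.
  move=> s s' e; apply/funext => a.
  (* The window reduced to the unit and the single coordinate [a] reads off the value of the sign at
     [a]. *)
  have mem t : sval (bmul u (q t)) (returns z (gone G :: nil) (a :: nil) t).
    have [_ qD] := qP t; apply: DM uD qD _ _.
    by exists (gone G :: nil), (a :: nil).
  have ms' := mem s'; rewrite -e in ms'.
  have [g [gs gs']] := betaE (betaI (mem s) ms').
  have := gs (gone G) a (or_introl erefl) (or_introl erefl).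
  rewrite gs' ?gmul1; try by left.
  by case: (z _ a) (s a) (s' a) => [] [] [].
move=> s; have [Ls _] := qP s; split; first exact: minimal_idealM.
by rewrite bmulA uu.
Qed.

End Beta.

(** * Automorphisms of minimal flows *)

Section Flows.
Variable G : group.
Implicit Types (X Y : flow G) (p q : beta G).

Lemma fopenI X (U V : X -> Prop) : fopen X U -> fopen X V ->
  fopen X (fun x => U x /\ V x).
Proof. by have [_ [oI _]] := ftop X; apply: oI. Qed.

Lemma fopenT X : fopen X (fun=> True).
Proof. by have [] := ftop X. Qed.

Lemma fopen_local X (U : X -> Prop) :
  (forall x, U x -> exists V, [/\ fopen X V, V x & forall y, V y -> U y]) ->
  fopen X U.
Proof.
move=> Uloc; have [_ [_ oU]] := ftop X.
have -> : U = (fun x => exists V, (fopen X V /\ forall y, V y -> U y) /\ V x).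
  apply/funext => x; apply/propext; split=> [/Uloc[V [oV Vx VU]]|[V [[_ VU] Vx]]].
    by exists V.
  exact: VU.
by apply: oU => V [].
Qed.

(** Cover the space by [U] and the open sets missing some neighbourhood of [x]. From a finite
    subcover, [W] is the union of the sets of the second kind and [V] the intersection of their
    neighbourhoods. *)
Lemma fopen_regular X (U : X -> Prop) x : fopen X U -> U x ->
  exists V W, [/\ fopen X V, fopen X W, V x, forall y, V y -> W y -> False &
    forall y, U y \/ W y].
Proof.
move=> oU Ux.
pose F (W : X -> Prop) := fopen X W /\
  (W = U \/ exists V, [/\ fopen X V, V x & forall y, V y -> W y -> False]).
have [|y|l [lF lcov]] := @fcompact _ X F; first by move=> W [].
  have [Uy|nUy] := pselect (U y); first by exists U; split=> //; split=> //; left.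
  have [|V [W [oV [oW [Vx [Wy VW]]]]]] := @fhausdorff _ X x y.
    by move=> e; apply: nUy; rewrite -e.
  by exists W; split=> //; split=> //; right; exists V.
have {lF} [V [W [oV oW Vx VW cov]]] : exists V W, [/\ fopen X V, fopen X W, V x,
    forall y, V y -> W y -> False &
    forall y, (exists W', In W' l /\ W' y) -> U y \/ W y].
  elim: {lcov} l lF => [|W' l IH] lF.
    exists (fun=> True), (fun=> False); split=> //.
    - exact: fopenT.
    - by apply: fopen_local.
    - by move=> y [W []].
  have [|V [W [oV oW Vx VW cov]]] := IH; first by move=> W'' ?; apply: lF; right.
  have [|oW' [->|[V' [oV' V'x V'W']]]] := lF W'; first by left.
    exists V, W; split=> // y [W'' [[<-|lW''] W''y]]; first by left.
    by apply: cov; exists W''.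
  exists (fun y => V y /\ V' y), (fun y => W y \/ W' y); split=> //.
  - exact: fopenI.
  - apply: fopen_local => y [Wy|W'y].
      by exists W; split=> // z; left.
    by exists W'; split=> // z; right.
  - by move=> y [Vy V'y] [/(VW y Vy)|/(V'W' y V'y)].
  - move=> y [W'' [[<-|lW''] W''y]]; first by right; right.
    by have [|?|?] := cov y; [exists W''|left|right; left].
by exists V, W; split=> // y; apply: cov; apply: lcov.
Qed.

Definition is_plim X p (y x : X) :=
  forall U, fopen X U -> U x -> sval p [set g | U (act X g y)].

Lemma plim_ex X p (y : X) : exists x, is_plim p y x.
Proof.
apply: contrapT => nlim.
pose F U := fopen X U /\ ~ sval p [set g | U (act X g y)].
have [U []//|x|l [lF lcov]] := @fcompact _ X F.
  apply: contrapT => no; apply: nlim; exists x => U oU Ux.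
  by apply: contrapT => npU; apply: no; exists U.
have [U /lF[]//|] := @betaN_In _ p _ (fun U => [set g | U (act X g y)]) l.
by apply: betaS (betaT p) => g _; have [U [? ?]] := lcov (act X g y); exists U.
Qed.

Lemma plim_uniq X p (y x x' : X) : is_plim p y x -> is_plim p y x' -> x = x'.
Proof.
move=> px px'; apply: contrapT => /fhausdorff[U [V [oU [oV [Ux [Vx' UV]]]]]].
by have [g [/UV]] := betaE (betaI (px _ oU Ux) (px' _ oV Vx')).
Qed.

Definition plim X p (y : X) : X := sval (cid (plim_ex p y)).

Lemma plimP X p (y : X) : is_plim p y (plim p y).
Proof. exact: svalP (cid (plim_ex p y)). Qed.

Lemma plimE X p (y x : X) : is_plim p y x -> plim p y = x.
Proof. by apply: plim_uniq; apply: plimP. Qed.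

Lemma plimM X p q (y : X) : plim (bmul p q) y = plim p (plim q y).
Proof.
apply: plimE => U oU /(plimP oU); apply: betaS => g /(plimP (act_cont X g U oU)).
by apply: betaS => h /=; rewrite actM.
Qed.

Lemma plim_bunit X g (y : X) : plim (bunit g) y = act X g y.
Proof. by apply: plimE => U oU. Qed.

Lemma plim_morph X Y (f : X -> Y) p (x : X) :
  fcontinuous X Y f -> equivariant X Y f -> f (plim p x) = plim p (f x).
Proof.
move=> cf ef; apply/esym; apply: plimE => U oU /(plimP (cf _ oU)).
by apply: betaS => g /=; rewrite ef.
Qed.

(** Continuity of [plim] in the ultrafilter. Regularity is used because a limit of points of [V]
    lies only in the closure of [V]. *)
Lemma open_plim X (U : X -> Prop) (x : X) p : fopen X U -> U (plim p x) ->
  exists2 A, sval p A & forall q, sval q A -> U (plim q x).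
Proof.
move=> oU Upx; have [V [W [oV oW Vpx VW UW]]] := fopen_regular oU Upx.
exists [set g | V (act X g x)] => [|q qA]; first exact: plimP Vpx.
have [//|/(plimP oW) qW] := UW (plim q x).
by have [g [/VW]] := betaE (betaI qA qW).
Qed.

(** * A minimal left ideal as a minimal flow *)

Section MinimalIdealFlow.
Variable L : set (beta G).
Hypothesis minL : minimal_ideal L.

Definition Lcar := {p | L p}.

Definition Lopen (U : Lcar -> Prop) := forall p : Lcar, U p ->
  exists2 A, sval (sval p) A & forall q : Lcar, sval (sval q) A -> U q.

Lemma Lopen_set A : Lopen (fun p : Lcar => sval (sval p) A).
Proof. by move=> p pA; exists A. Qed.

Lemma Ltop : is_topology Lopen.
Proof.
split; first by move=> p _; exists setT => //; apply: betaT.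
split=> [U V oU oV p [Up Vp]|F FO p [U [FU Up]]].
  have [[A pA AU] [B pB BV]] := (oU p Up, oV p Vp).
  exists (A `&` B) => [|q qAB]; first exact: betaI.
  by split; [apply: AU|apply: BV]; apply: betaS qAB => g [].
have [A pA AU] := FO U FU p Up; exists A => // q qA.
by exists U; split=> //; apply: AU.
Qed.

(** [D] consists of the complements of finite unions of basic open sets subordinate to the cover;
    without a finite subcover, [beta_compact] yields an uncovered point. *)
Lemma Lcompact : compact_sp Lopen.
Proof.
move=> F FO Fcov; apply: contrapT => nofin.
pose P A := exists2 U, F U & forall q : Lcar, sval (sval q) A -> U q.
pose D := [set B | exists2 l, (forall A, In A l -> P A) &
  B = [set g | forall A, In A l -> ~ A g]].
have [|||p Lp pD] := @beta_compact _ L D.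
- by case: minL.
- split.
    by exists setT; exists nil => //; apply/seteqP; split=> [g _ A []|].
  move=> _ _ [l lP ->] [l' l'P ->].
  exists [set g | forall A, In A (l ++ l') -> ~ A g].
    by exists (l ++ l') => // A /in_app_iff[/lP|/l'P].
  by move=> g gP; split=> A Al; apply: gP; apply/in_app_iff; [left|right].
- move=> _ [l lP ->]; apply: contrapT => no; apply: nofin.
  have /choice[Uof UofP] : forall A, exists U, In A l ->
      F U /\ forall q : Lcar, sval (sval q) A -> U q.
    move=> A; have [/lP[U FU AU]|nAl] := pselect (In A l); first by exists U.
    by exists (fun=> True).
  exists (map Uof l); split=> [U /in_map_iff[A [<- /UofP[]]] //|q].
  apply: contrapT => nq; apply: no; exists (sval q); first exact: svalP.
  have : ~ sval (sval q) [set g | exists2 A, In A l & A g].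
    apply: (@betaN_In _ _ _ id) => A Al qA; apply: nq; exists (Uof A).
    split; first by apply/in_map_iff; exists A.
    by have [_] := UofP A Al; apply.
  by move/betaC; apply: betaS => g ng A Al Ag; apply: ng; exists A.
have [U [FU Up]] := Fcov (exist _ p Lp); have [A pA AU] := FO U FU _ Up.
apply: (@betaNC _ p A) => //; apply: pD; exists (A :: nil).
  by move=> _ [<-|[]]; exists U.
by apply/seteqP; split=> [g nA _ [<-|[]] //|g]; apply; left.
Qed.

Lemma Lhausdorff : hausdorff_sp Lopen.
Proof.
move=> [p Lp] [q Lq] pq.
have [A pA nqA] : exists2 A, sval p A & ~ sval q A.
  apply: contrapT => no; apply: pq.
  have e : p = q.
    by apply: beta_eq => A pA; apply: contrapT => ?; apply: no; exists A.
  by subst q; congr exist; apply: Prop_irrelevance.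
exists (fun r : Lcar => sval (sval r) A), (fun r : Lcar => sval (sval r) (~` A)).
split; first exact: Lopen_set.
split; first exact: Lopen_set.
split=> //; split; first exact: betaC.
by move=> r; apply: betaNC.
Qed.

Definition Lact (g : G) (p : Lcar) : Lcar :=
  exist _ (bmul (bunit g) (sval p)) (minimal_idealM minL (bunit g) (svalP p)).

Lemma Lcar_eq (p q : Lcar) : sval p = sval q -> p = q.
Proof.
by case: p q => p Lp [q Lq] /= e; subst q; congr exist; apply: Prop_irrelevance.
Qed.

Lemma Lact1 (p : Lcar) : Lact (gone G) p = p.
Proof. by apply: Lcar_eq; apply: bunit1. Qed.

Lemma LactM g h (p : Lcar) : Lact (g ** h) p = Lact g (Lact h p).
Proof. by apply: Lcar_eq; rewrite /= bunitM bmulA. Qed.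

Lemma Lact_cont g U : Lopen U -> Lopen (fun p : Lcar => U (Lact g p)).
Proof.
move=> oU p /oU[A pA AU]; exists [set h | A (g ** h)] => // q qA.
exact: AU.
Qed.

Definition Lflow : flow G :=
  @Flow G _ _ Ltop Lcompact Lhausdorff _ Lact1 LactM Lact_cont.

Lemma Lflow_minimal : minimal_flow Lflow.
Proof.
have [clL [p Lp] invL Lmin] := minL; split; first by exists (exist _ p Lp).
move=> C clC invC; have [[y Cy]|nC] := pselect (exists y, C y); last first.
  by left=> x Cx; apply: nC; exists x.
right; pose C' := [set p | exists2 x, C x & sval x = p].
have LC' : L `<=` C'.
  apply: Lmin.
  - by move=> _ [x _ <-]; apply: svalP.
  - move=> r rP; have Lr : L r.
      by apply: clL => A /rP[_ [x _ <-] xA]; exists (sval x) => //; apply: svalP.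
    exists (exist _ r Lr) => //; apply: contrapT => /clC[A rA AC].
    by have [_ [x Cx <-] /AC] := rP _ rA.
  - by exists (sval y), y.
  - by move=> g _ [x Cx <-]; exists (Lact g x) => //; apply: invC.
move=> x; have [x' Cx' x'x] := LC' _ (svalP x).
by have -> : x = x' by apply: Lcar_eq.
Qed.

Lemma plim_Lflow p (q : Lflow) : sval (plim p q) = bmul p (sval q).
Proof.
pose r : Lcar := exist _ (bmul p (sval q)) (minimal_idealM minL p (svalP q)).
suff -> : plim p q = r by [].
apply: plimE => U oU /oU[A /= rA AU]; apply: betaS rA => g gA.
exact: AU.
Qed.

End MinimalIdealFlow.

(** * Rigidity of endomorphisms, the upper bound and non-proximality *)

Section MinimalFlows.
Variable M : flow G.
Hypothesis minM : minimal_flow M.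

Definition endomorphism X (f : X -> X) := fcontinuous X X f /\ equivariant X X f.

Lemma endomorphism_id : endomorphism (@id M).
Proof. by split. Qed.

Lemma endomorphism_comp f g :
  endomorphism f -> endomorphism g -> endomorphism (fun x : M => f (g x)).
Proof.
move=> [cf ef] [cg eg]; split; last by move=> h x; rewrite eg ef.
by move=> U /cf/cg.
Qed.

Lemma endomorphism_eq f g (m : M) : endomorphism f -> endomorphism g ->
  f m = g m -> f = g.
Proof.
move=> [cf ef] [cg eg] fgm; have [_ minC] := minM.
have [||none|all] := minC (fun x => f x = g x).
- apply: fopen_local => x /fhausdorff[U [V [oU [oV [Ux [Vx UV]]]]]].
  exists (fun y => U (f y) /\ V (g y)); split=> //.
    by apply: fopenI; [apply: cf|apply: cg].
  by move=> y [Uy Vy] e; apply: (UV (f y)); rewrite // e.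
- by move=> h x e; rewrite ef eg e.
- by case: (none m).
- exact/funext.
Qed.

Lemma orbit_dense (U : M -> Prop) x y : fopen M U -> U y ->
  exists g, U (act M g x).
Proof.
move=> oU Uy; have [_ minC] := minM; apply: contrapT => no.
have [||none|all] := minC (fun x => ~ exists g, U (act M g x)).
- apply: fopen_local => z /contrapT[g Ug]; exists (fun z => U (act M g z)).
  by split=> //; [apply: act_cont|move=> w Uw; apply; exists g].
- by move=> g z nz [h]; rewrite -actM => Uz; apply: nz; exists (h ** g).
- exact: none no.
- by apply: (all y); exists (gone G); rewrite act1.
Qed.

Lemma flow_aut_eq (f g : flow_aut M) (m : M) : sval f m = sval g m -> f = g.
Proof.
case: f g => f fP [g gP] /= e; have fg : f = g.
  by apply: endomorphism_eq e; [case: fP|case: gP].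
by subst g; congr exist; apply: Prop_irrelevance.
Qed.

(** An automorphism is determined by the image of one point [m], and a point by the subsets of the
    dense orbit of [m] having it in their closure. These subsets are coded by functions from [nat]
    to [bool]. *)
Lemma flow_aut_code : countable_type G ->
  exists c : flow_aut M -> ((nat -> bool) -> bool), injective c.
Proof.
move=> [e eI]; have [[m _] _] := minM.
exists (fun f s => `[< forall U, fopen M U -> U (sval f m) ->
  exists2 g, s (e g) = true & U (act M g m) >]).
move=> f f' ff'; apply: (@flow_aut_eq _ _ m); apply: contrapT => /fhausdorff.
move=> [U [V [oU [oV [Ux [Vx UV]]]]]].
pose s n := `[< exists2 g, e g = n & U (act M g m) >].
have sE g : s (e g) = true <-> U (act M g m).
  split=> [/asboolP[h /eI ->] //|Ug]; by apply/asboolP; exists g.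
have : `[< forall U, fopen M U -> U (sval f m) ->
    exists2 g, s (e g) = true & U (act M g m) >].
  apply/asboolP => W oW Wx.
  have [|g [Ug Wg]] := orbit_dense m (fopenI oU oW) (y := sval f m); first by [].
  by exists g => //; apply/sE.
rewrite (congr1 (fun c => c s) ff') => /asboolP/(_ V oV Vx)[g /sE Ug Vg].
exact: UV Ug Vg.
Qed.

(** Applying [f'] after the inverse of [f] to the first net gives the second. Both converge to [y],
    so [f] and [f'] agree at the preimage of [y] under [f]. *)
Lemma minimal_not_proximal (f f' : flow_aut M) :
  f <> f' -> ~ proximal_flow M.
Proof.
have [[m _] _] := minM.
move=> ff' prox.
have [y [I [le [g [[_ [_ [_ dir]]] [fy f'y]]]]]] := prox (sval f m) (sval f' m).
have [[h [hf [fh ch]]] [cf ef]] := svalP f; have [_ [cf' ef']] := svalP f'.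
apply: ff'; apply: (@flow_aut_eq _ _ (h y)); rewrite fh; apply: contrapT.
move=> /fhausdorff[U [V [oU [oV [Uy [Vy UV]]]]]].
have oW : fopen M (fun x => V (sval f' (h x))) by apply: (ch _ (cf' _ oV)).
have [[i1 i1P] [i2 i2P]] := (fy _ oW Vy, f'y _ oU Uy).
have [i [i1i i2i]] := dir i1 i2.
have := i1P i i1i; rewrite -ef hf ef'; exact: UV (i2P i i2i).
Qed.

End MinimalFlows.

Lemma flow_aut_signs (M : flow G) : countable_type G -> infinite_type G ->
  universal_minimal_flow M ->
  exists a : ((nat -> bool) -> bool) -> flow_aut M, injective a.
Proof.
move=> ctblG infG [minM univM].
have [L minL] := minimal_ideal_ex G.
have [u [q [Lu uu qI qP]]] := signed_elements minL ctblG infG.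
have [i [ci [ei _]]] := univM _ (Lflow_minimal minL).
(* Replacing [m1] by its [u]-limit places the image of [m0] in the group [uL]. *)
have [[m1 _] _] := minM; pose m0 := plim u m1.
have um0 : plim u m0 = m0 by rewrite /m0 -plimM uu.
have iM p m : sval (i (plim p m)) = bmul p (sval (i m)).
  by rewrite (plim_morph p m ci ei) plim_Lflow.
pose q0 := sval (i m0); have Lq0 : L q0 := svalP (i m0).
have uq0 : bmul u q0 = q0 by rewrite -iM um0.
have [r [Lr ur rq0 q0r]] := minimal_ideal_inv minL Lu uu Lq0 uq0.
(* The inverse [r] of [q0] is inserted so that [f p] sends [m0] to its limit along [p] whenever [p]
   is in [uL]. *)
pose f p (m : M) := plim (sval (i m)) (plim (bmul r p) m0).
have fE p : endomorphism (f p).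
  split.
    move=> U oU; apply: (ci (fun x => U (plim (sval x) (plim (bmul r p) m0)))).
    by move=> x /(open_plim oU)[A xA AU]; exists A => // y /AU.
  by move=> g m; rewrite /f ei /= plimM plim_bunit.
have fm0 p : bmul u p = p -> f p m0 = plim p m0.
  by move=> up; rewrite /f -plimM bmulA -/q0 q0r up.
have fK p p' : bmul u p = p -> bmul u p' = p' -> bmul p' p = u ->
    forall m, f p (f p' m) = m.
  move=> up up' p'p m.
  suff e : (fun m => f p (f p' m)) = id by rewrite (congr1 (fun h => h m) e).
  apply: (@endomorphism_eq M minM _ _ m0); first exact: endomorphism_comp.
    exact: endomorphism_id.
  (* Endomorphisms commute with limits, so the composite reverses the order: it sends [m0] to its
     limit along [bmul p' p]. *)
  have [cf ef] := fE p; rewrite fm0 // (plim_morph p' m0 cf ef) fm0 //.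
  by rewrite -plimM p'p.
have aut s : is_flow_aut M (f (q s)).
  have [Lqs uqs] := qP s.
  have [t [Lt ut tq qt]] := minimal_ideal_inv minL Lu uu Lqs uqs.
  split; last exact: fE.
  by exists (f t); split; [apply: fK|split; [apply: fK|have [] := fE t]].
exists (fun s => exist _ (f (q s)) (aut s)) => s s' /(congr1 sval) /= ss'.
apply: qI; have [[Ls us] [Ls' us']] := (qP s, qP s').
have : plim (q s) m0 = plim (q s') m0 by rewrite -!fm0 // ss'.
(* Mapping to [L] by [i] gives [bmul (q s) q0 = bmul (q s') q0]; multiplying by [r] on the right
   removes [q0]. *)
move=> /(congr1 (fun m => bmul (sval (i m)) r)); rewrite /= !(iM _ m0) -!bmulA -/q0 q0r.
by rewrite !(minimal_ideal_mulru minL Lu uu).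
Qed.

End Flows.

Lemma injective_equinumerous (A B : Type) (f : A -> B) (g : B -> A) :
  injective f -> injective g -> equinumerous A B.
Proof.
elim/Ppointed: A f g => A f g fI gI.
  by exists f; split=> // b; case: (no (g b)).
elim/Ppointed: B f g fI gI => B f g fI gI; first by case: (no (f point)).
have /card_set_bijP[h [_ hI hS]] : ([set: A] #= [set: B])%card.
  by apply: Cantor_Bernstein; apply/pcard_injP; [exists f|exists g] => x y _ _;
    [apply: fI|apply: gI].
exists h; split=> [x y|b]; first by apply: hI; rewrite inE.
by have [a _] := hS b Logic.I; exists a.
Qed.

Theorem theorem11p3 (G : group) (M : flow G) :
  countable_type G -> infinite_type G -> universal_minimal_flow M ->
  equinumerous (flow_aut M) ((nat -> bool) -> bool) /\ ~ proximal_flow M.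
Proof.
move=> ctblG infG univM; have [minM _] := univM.
have [a aI] := flow_aut_signs ctblG infG univM.
have [c cI] := flow_aut_code minM ctblG.
split; first exact: injective_equinumerous cI aI.
apply: (minimal_not_proximal minM (f := a (fun=> true)) (f' := a (fun=> false))).
by move=> /aI /(congr1 (fun s => s (fun=> true))).
Qed.
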